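(* For every fixed positive integer $d$, let $f_d(n)$ be the largest integer such that every poset on $n$ elements has a subposet on $f_d(n)$ elements of dimension at most $d$. Then \[ f_d(n) = O\left(n^{\frac{d}{d+1}}\right) \quad (n\to\infty), \] where the implied constant may depend on $d$.
   Context: A subposet of a poset $P$ is a subset of its ground set with the order induced from $P$. The dimension of a poset $P$ is the least integer $d$ such that there are $d$ linear extensions of $P$ whose intersection is $P$ (equivalently, the least $d$ such that $P$ embeds into $\mathbb{R}^d$ with the coordinatewise product order). *)

(* Defs.v *)
From mathcomp Require Import all_boot.
Set Implicit Arguments. Unset Strict Implicit. Unset Printing Implicit Defensive.

Notation relI n := {set 'I_n * 'I_n}.

Definition is_poset n (P : relI n) : bool :=
  [&& [forall x, (x, x) \in P],
      [forall x, forall y, ((x, y) \in P) && ((y, x) \in P) ==> (x == y)] &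
      [forall x, forall y, forall z,
         ((x, y) \in P) && ((y, z) \in P) ==> ((x, z) \in P)]].

Definition is_lin_ext n (P : relI n) (S : {set 'I_n}) (L : relI n) : bool :=
  [&& [forall x in S, (x, x) \in L],
      [forall x in S, forall y in S,
         ((x, y) \in L) && ((y, x) \in L) ==> (x == y)],
      [forall x in S, forall y in S, forall z in S,
         ((x, y) \in L) && ((y, z) \in L) ==> ((x, z) \in L)],
      [forall x in S, forall y in S, ((x, y) \in L) || ((y, x) \in L)] &
      [forall x in S, forall y in S, ((x, y) \in P) ==> ((x, y) \in L)]].

Definition is_realizer n (P : relI n) (S : {set 'I_n}) k
    (Ls : {ffun 'I_k -> relI n}) : bool :=
  [forall i, is_lin_ext P S (Ls i)] &&
  [forall x in S, forall y in S, ((x, y) \in P) == [forall i, (x, y) \in Ls i]].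

Definition dim_le n (P : relI n) (S : {set 'I_n}) (d : nat) : bool :=
  [exists k : 'I_d.+1, [exists Ls : {ffun 'I_k -> relI n}, is_realizer P S Ls]].

Definition f_dim (d n : nat) : nat :=
  \max_(m < n.+1 | [forall P : relI n, is_poset P ==>
                      [exists S : {set 'I_n}, (#|S| == m) && dim_le P S d]]) m.

(* Main.v *)
(** The poset is a set of [n] points of the grid [[K]^(d+1)] under the
    coordinatewise order, with [K] about [n^(1/(d+1))].  A set of more than
    [C * K^d] grid points contains every [d+1]-dimensional pattern of bounded
    size (the Klazar-Marcus extension of the Marcus-Tardos theorem), and the
    standard example of dimension [d+1] is such a pattern.

    Klazar-Marcus is proved by induction on the number of coordinates.  Cut the
    grid into blocks of bounded side [s].  The set of nonempty blocks avoids the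
    pattern on a grid [s] times smaller.  A block that takes fewer than [q] values
    in each coordinate holds at most [q^(d+1)] points.  The remaining blocks are
    wide in some coordinate [t]: they take at least [q] values there.  Blocks wide
    in [t], with the same [t]-coordinate and the same values inside the block,
    avoid the pattern in the other coordinates, since coordinate [t] can then be
    arranged freely; so the induction hypothesis bounds their number. *)
Require Import Defs.
From mathcomp Require Import all_boot.
Set Implicit Arguments. Unset Strict Implicit. Unset Printing Implicit Defensive.

(** * Patterns in grids *)

(* [sg t] ranks the points of the pattern along coordinate [t]; points of equal
   rank may be placed in any relative order. *)
Definition contains (T K : finType) (q N : nat) (sg : T -> K -> 'I_q)
    (I : {set T}) (A : {set {ffun T -> 'I_N}}) : Prop :=
  exists p : K -> {ffun T -> 'I_N}, (forall i, p i \in A) /\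
    forall t, t \in I -> forall i j, sg t i < sg t j -> p i t < p j t.

(** Freezing the coordinates outside [I] models a grid of dimension [#|I|] inside the fixed type
    [{ffun T -> 'I_N}], so the induction on dimension never changes the type. *)
Definition const_outside (T : finType) (N : nat) (I : {set T})
    (A : {set {ffun T -> 'I_N}}) : Prop :=
  forall x y, x \in A -> y \in A -> forall t, t \notin I -> x t = y t.

Lemma card_le_fibers (X Y : finType) (f : X -> Y) (A : {set X}) (B : {set Y})
    (c : nat) :
  (forall x, x \in A -> f x \in B) ->
  (forall y, y \in B -> #|[set x in A | f x == y]| <= c) ->
  #|A| <= #|B| * c.
Proof.
move=> fAB cB; rewrite -sum1_card (partition_big f (mem B)) //=.
rewrite -sum_nat_const; apply: leq_sum => y By.
apply: leq_trans (cB y By); rewrite -sum1_card.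
by under [X in _ <= X]eq_bigl => x do rewrite inE.
Qed.

Lemma card_bigcup_le (X Y : finType) (F : X -> {set Y}) (I : {set X}) (c : nat) :
  (forall t, t \in I -> #|F t| <= c) -> #|\bigcup_(t in I) F t| <= #|I| * c.
Proof.
move=> cF; rewrite -sum_nat_const.
elim/big_ind2: _ => [|m A n B leA leB|//]; first by rewrite cards0.
by apply: leq_trans (leq_card_setU _ _) _; apply: leq_add.
Qed.

Lemma card_const_outside (T : finType) (N : nat) (I : {set T})
    (A : {set {ffun T -> 'I_N}}) (q : nat) :
  const_outside I A ->
  (forall t, t \in I -> #|[set x t | x : {ffun T -> 'I_N} in A]| <= q) ->
  #|A| <= q ^ #|I|.
Proof.
move=> constA leq_val.
pose F t := [set x t | x : {ffun T -> 'I_N} in A].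
have sAF : A \subset family (fun t => mem (F t)).
  by apply/subsetP=> x xA; apply/familyP=> t; apply: imset_f.
apply: leq_trans (subset_leq_card sAF) _.
rewrite card_family foldrE big_image /= (bigID (mem I)) /=.
rewrite -[q ^ _]muln1 -prod_nat_const; apply: leq_mul; first exact: leq_prod.
apply: (big_ind (fun m => m <= 1)) => [//|m1 m2 le1 le2|t tI].
  exact: leq_mul le1 le2.
apply/card_le1_eqP => _ _ /imsetP[x xA ->] /imsetP[y yA ->].
exact: constA.
Qed.

Lemma increasing_enum (N q : nat) (V : {set 'I_N}) :
  q <= #|V| -> exists r : 'I_q -> 'I_N,
    (forall i, r i \in V) /\ (forall i j : 'I_q, i < j -> r i < r j).
Proof.
move=> leqV; exists (fun i => enum_val (widen_ord leqV i)).
split=> [i|i j ltij]; first exact: enum_valP.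
have x0 : 'I_N := enum_val (widen_ord leqV i).
rewrite !(enum_val_nth x0) /=.
have srt : sorted (fun a b : 'I_N => a < b) (enum V).
  rewrite {1}/enum_mem -enumT; apply: sorted_filter.
    by move=> a b c; apply: ltn_trans.
  have := iota_ltn_sorted 0 N.
  by rewrite -val_enum_ord sorted_map.
apply: (sorted_ltn_nth _ x0 srt) => //; first by move=> a b c; apply: ltn_trans.
- by rewrite inE -cardE (leq_trans (ltn_ord i)).
- by rewrite inE -cardE (leq_trans (ltn_ord j)).
Qed.

(** * Cutting the grid into blocks *)

Lemma ltn_block (s M : nat) (v : 'I_(s * M)) : v %/ s < M.
Proof.
case: s v => [[]//|s v].
by rewrite ltn_divLR // [M * _]mulnC ltn_ord.
Qed.

Lemma ltn_glue (s M : nat) (b : 'I_M) (r : 'I_s) : b * s + r < s * M.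
Proof.
apply: (@leq_trans (b.+1 * s)); first by rewrite mulSn addnC ltn_add2r.
by rewrite mulnC leq_mul2l ltn_ord orbT.
Qed.

Definition block (T : finType) (s M : nat) (x : {ffun T -> 'I_(s * M)}) :
  {ffun T -> 'I_M} := [ffun t => Ordinal (ltn_block (x t))].

Definition glue (s M : nat) (b : 'I_M) (r : 'I_s) : 'I_(s * M) :=
  Ordinal (ltn_glue b r).

Definition offsets (T : finType) (s M : nat) (A : {set {ffun T -> 'I_(s * M)}})
    (t : T) (b : {ffun T -> 'I_M}) : {set 'I_s} :=
  [set r | [exists x in A, (block x == b) && (x t == glue (b t) r)]].

Lemma glue_block (T : finType) (s M : nat) (x : {ffun T -> 'I_(s * M)}) (t : T) :
  exists r : 'I_s, x t = glue (block x t) r.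
Proof.
have s0 : 0 < s by case: s x => // x; have [] := x t.
exists (Ordinal (ltn_pmod (x t) s0)); apply: val_inj.
by rewrite /= ffunE /= -divn_eq.
Qed.

Lemma block_lt (T : finType) (s M : nat) (x y : {ffun T -> 'I_(s * M)}) (t : T) :
  block x t < block y t -> x t < y t.
Proof. by rewrite !ffunE /= !ltnNge; apply: contra => /leq_div2r->. Qed.

Lemma block_const_outside (T : finType) (s M : nat) (I : {set T})
    (A : {set {ffun T -> 'I_(s * M)}}) :
  const_outside I A -> const_outside I [set block x | x in A].
Proof.
move=> cA _ _ /imsetP[x xA ->] /imsetP[y yA ->] t tI.
by rewrite !ffunE; apply: val_inj => /=; rewrite (cA x y).
Qed.

(** A pattern asks only for strict inequalities, and these pass from blocks to any points chosen in
    them. *)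
Lemma block_contains (T K : finType) (q s M : nat) (sg : T -> K -> 'I_q)
    (I : {set T}) (A : {set {ffun T -> 'I_(s * M)}}) :
  contains sg I [set block x | x in A] -> contains sg I A.
Proof.
case=> p [pA ltp].
have /fin_all_exists[p' p'P] i : exists x, x \in A /\ p i = block x.
  by have /imsetP[x] := pA i; exists x.
exists p'; split=> [i|t tI i j sij]; first by have [] := p'P i.
by apply: block_lt; have [_ <-] := p'P i; have [_ <-] := p'P j; apply: ltp.
Qed.

(** Wide blocks are sorted by the pair [(b t, offsets A t b)], which takes at most [M * 2 ^ s]
    values; [c] bounds each class. *)
Lemma card_wide_blocks (T K : finType) (q s M : nat) (sg : T -> K -> 'I_q)
    (I : {set T}) (A : {set {ffun T -> 'I_(s * M)}}) (t : T) (c : nat) :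
  const_outside I A -> ~ contains sg I A ->
  (forall B : {set {ffun T -> 'I_M}},
     const_outside (I :\ t) B -> ~ contains sg (I :\ t) B -> #|B| <= c) ->
  #|[set b in [set block x | x in A] | q <= #|offsets A t b|]| <= M * 2 ^ s * c.
Proof.
move=> cA nA cB; set W := [set b in _ | _].
pose f (b : {ffun T -> 'I_M}) := (b t, offsets A t b).
have -> : M * 2 ^ s = #|[set: 'I_M * {set 'I_s}]|.
  rewrite cardsT card_prod card_ord; congr (_ * _).
  by rewrite -cardsT -powersetT card_powerset cardsT card_ord.
apply: (@card_le_fibers _ _ f) => [b _|[v R] _]; first by rewrite inE.
have [qR|Rq] := leqP q #|R|; last first.
  rewrite (_ : [set b in W | _] = set0) ?cards0 //.
  apply/setP=> b; rewrite !inE; apply/negP => /andP[/andP[_ qb] /eqP[_ eqR]].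
  by move: qb; rewrite eqR leqNgt Rq.
have inF b : b \in [set b in W | f b == (v, R)] ->
    [/\ b \in [set block x | x in A], b t = v & offsets A t b = R].
  by rewrite inE => /andP[]; rewrite inE => /andP[bA _] /eqP[].
apply: cB => [b1 b2 /inF[b1A b1t _] /inF[b2A b2t _] u|].
  rewrite !inE negb_and negbK => /orP[/eqP->|uI]; first by rewrite b1t b2t.
  exact: (block_const_outside cA).
case=> p [pF ltp]; apply: nA.
(* The blocks of a class share the offset set [R], so the block of pattern point [i] holds a point
   of [A] with offset [r (sg t i)]. These points are ordered correctly along [t]; along the other
   coordinates their blocks already are. *)
have [r [rR ltr]] := increasing_enum qR.
have /fin_all_exists[p' p'P] i :
    exists x, [/\ x \in A, block x = p i & x t = glue v (r (sg t i))].
  have [_ pt pR] := inF _ (pF i).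
  have := rR (sg t i); rewrite -pR inE => /existsP[x /and3P[xA /eqP xb /eqP xt]].
  by exists x; rewrite -pt -xt.
exists p'; split=> [i|u uI i j sij]; first by have [] := p'P i.
have [_ bi ti] := p'P i; have [_ bj tj] := p'P j.
have [eut|neut] := eqVneq u t.
  by move: sij; rewrite eut ti tj /= ltn_add2l; apply: ltr.
by apply: block_lt; rewrite bi bj; apply: ltp => //; rewrite !inE neut.
Qed.


(** A block wide in no coordinate of [I] holds at most [q ^ #|I|] points of [A], any other block at
    most [s ^ #|I|]. *)
Lemma card_by_blocks (T : finType) (q s M w : nat) (I : {set T})
    (A : {set {ffun T -> 'I_(s * M)}}) :
  const_outside I A ->
  (forall t, t \in I ->
     #|[set b in [set block x | x in A] | q <= #|offsets A t b|]| <= w) ->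
  #|A| <= #|[set block x | x in A]| * q ^ #|I| + #|I| * w * s ^ #|I|.
Proof.
move=> cA lew; set B := [set block x | x in A].
pose W := \bigcup_(t in I) [set b in B | q <= #|offsets A t b|].
have cfiber b m : (forall t, t \in I -> #|offsets A t b| <= m) ->
    #|[set x in A | block x == b]| <= m ^ #|I|.
  move=> lem; apply: card_const_outside => [x y|t tI].
    by rewrite !inE => /andP[xA _] /andP[yA _]; apply: cA.
  apply: leq_trans (lem t tI).
  apply: leq_trans (leq_imset_card (glue (b t)) (mem (offsets A t b))).
  apply: subset_leq_card.
  apply/subsetP=> v /imsetP[x]; rewrite inE => /andP[xA /eqP xb] {v}->.
  have [r] := glue_block x t; rewrite xb => xr.
  rewrite xr; apply: imset_f; rewrite inE; apply/existsP; exists x.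
  by rewrite xA xb xr !eqxx.
rewrite -(cardsID [set x | block x \in W] A) addnC; apply: leq_add.
  apply: (@leq_trans (#|B :\: W| * q ^ #|I|)); last first.
    by rewrite leq_mul2r subset_leq_card ?orbT ?subsetDl.
  apply: (@card_le_fibers _ _ (@block T s M)) => [x|b].
    by rewrite !inE => /andP[-> xA]; rewrite imset_f.
  rewrite inE => /andP[bW bB].
  apply: leq_trans (cfiber b q _); last first.
    move=> t tI; rewrite leqNgt; apply: contra bW => ltq.
    by apply/bigcupP; exists t; rewrite // inE bB ltnW.
  by apply/subset_leq_card/subsetP=> x; rewrite !inE => /andP[/andP[_ ->]].
apply: (@leq_trans (#|W| * s ^ #|I|)); last first.
  by rewrite leq_mul2r card_bigcup_le ?orbT.
apply: (@card_le_fibers _ _ (@block T s M)) => [x|b _].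
  by rewrite !inE => /andP[].
apply: leq_trans (cfiber b s _); last first.
  by move=> t _; rewrite -[X in _ <= X]card_ord max_card.
by apply/subset_leq_card/subsetP=> x; rewrite !inE => /andP[/andP[-> _]].
Qed.

(** The side is a power of [s = 2 * q ^ 2] so that blocks of side [s] tile the grid exactly at every
    scale. *)
Lemma klazar_marcus (T K : finType) (q : nat) (sg : T -> K -> 'I_q) (i : nat) :
  0 < q -> exists C : nat, forall (I : {set T}) (m N : nat),
    #|I| = i.+1 -> N = (2 * q ^ 2) ^ m ->
    forall A : {set {ffun T -> 'I_N}},
      const_outside I A -> ~ contains sg I A -> #|A| <= C * N ^ i.
Proof.
move=> q0; set s := 2 * q ^ 2; elim: i => [|i [C' IH]].
  (* On a line, any [q] points contain the pattern: place each pattern point by its rank. *)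
  exists q => I m N /eqP/cards1P[t ->] _ A cA nA.
  rewrite expn0 muln1 leqNgt; apply/negP => /ltnW leqA; apply: nA.
  have injt : {in A &, injective (fun x : {ffun T -> 'I_N} => x t)}.
    move=> x y xA yA xyt; apply/ffunP=> u.
    by have [->//|ut] := eqVneq u t; apply: cA; rewrite // inE.
  move: leqA; rewrite -(card_in_imset injt) => /increasing_enum[r [rA ltr]].
  have /fin_all_exists[p pP] k : exists x, x \in A /\ x t = r (sg t k).
    by have /imsetP[x xA ->] := rA (sg t k); exists x.
  exists p; split=> [k|u /set1P-> k l kl]; first by have [] := pP k.
  by have [_ ->] := pP k; have [_ ->] := pP l; apply: ltr.
(* The wide blocks contribute at most [E * M ^ i.+1] points. The successor in [E.+1] covers the
   one-point grid [m = 0]. *)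
pose E := i.+2 * (2 ^ s * C') * s ^ i.+2.
exists E.+1 => I m N cI; elim: m N => [|m IHm] N ->.
  move=> A _ _; apply: leq_trans (max_card _) _.
  by rewrite card_ffun card_ord expn0 !exp1n muln1.
rewrite expnS; set M := s ^ m => A cA nA.
have wide t : t \in I ->
    #|[set b in [set block x | x in A] | q <= #|offsets A t b|]|
      <= M * 2 ^ s * (C' * M ^ i).
  move=> tI; apply: (card_wide_blocks cA nA) => B.
  by apply: (IH _ m) => //; move: cI; rewrite (cardsD1 t) tI => -[].
apply: leq_trans (card_by_blocks cA wide) _; rewrite cI.
have lenB : #|[set block x | x in A]| <= E.+1 * M ^ i.+1.
  by apply: (IHm M) => //; [exact: block_const_outside | move/block_contains].
rewrite [(s * M) ^ _]expnMn.
(* This choice of [s] lets the narrow and the wide blocks each use at most half of the bound. *)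
have s_big : 2 * q ^ i.+2 <= s ^ i.+1.
  rewrite /s expnMn; apply: leq_mul; first by rewrite expnS leq_pmulr ?expn_gt0.
  by rewrite -expnM leq_pexp2l // mul2n -addnn addSn addnS ltnS leq_addr.
apply: (@leq_trans (E.+1 * M ^ i.+1 * (2 * q ^ i.+2))); last first.
  by rewrite [s ^ _ * _]mulnC -mulnA !leq_mul2l s_big !orbT.
rewrite mul2n -addnn mulnDr; apply: leq_add; first by rewrite leq_mul2r lenB orbT.
have -> : i.+2 * (M * 2 ^ s * (C' * M ^ i)) * s ^ i.+2 = E * M ^ i.+1.
  rewrite /E [M ^ i.+1]expnS; move: (2 ^ s) (s ^ i.+2) (M ^ i) (M) => a b c e.
  rewrite -!mulnA; congr (_ * _).
  by rewrite mulnCA [e * (C' * _)]mulnCA [e * _]mulnA [_ * b]mulnC.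
by rewrite -[X in X <= _]muln1 leq_mul ?expn_gt0 ?q0 // leq_mul2r leqnSn orbT.
Qed.

(** * Standard examples *)

(* The pattern points [(false, t)] and [(true, t)] are the minimal element [a_t]
   and the maximal element [b_t] of the standard example: coordinate [t] places
   [b_t] below [a_t], all other [a_u] below and all other [b_u] above both. *)
Definition standard_rank (T : finType) (t : T) (k : bool * T) : 'I_4 :=
  let: (top, u) := k in
  inord (if top then if u == t then 1 else 3 else if u == t then 2 else 0).

(** Each [t] needs a linear extension placing [b t] below [a t]. By pigeonhole one extension serves
    some [t != u], and then [a t <= b u <= a u <= b t] is a contradiction. *)
Lemma dim_standard_example (n d : nat) (P : relI n) (S : {set 'I_n})
    (T : finType) (a b : T -> 'I_n) :
  d < #|T| ->
  (forall t, a t \in S) -> (forall t, b t \in S) ->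
  (forall t u, ((a t, b u) \in P) = (t != u)) ->
  ~~ dim_le P S d.
Proof.
move=> ltdT aS bS abP; apply/negP => /existsP[k /existsP[Ls]].
case/andP=> /forallP Lext /forall_inP Lreal.
have /fin_all_exists[h hP] t : exists i, (a t, b t) \notin Ls i.
  apply/existsP; rewrite -negb_forall.
  have /forall_inP/(_ _ (bS t))/eqP <- := Lreal _ (aS t).
  by rewrite abP eqxx.
have /injectivePn[t [u tu htu]] : ~~ injectiveb h.
  apply/injectiveP => /leq_card; rewrite card_ord leqNgt.
  by rewrite (leq_trans (ltn_ord k) ltdT).
have /and5P[_ _ /forall_inP trL /forall_inP totL /forall_inP PL] := Lext (h t).
have tr x y z : x \in S -> y \in S -> z \in S ->
    (x, y) \in Ls (h t) -> (y, z) \in Ls (h t) -> (x, z) \in Ls (h t).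
  move=> xS yS zS xy yz.
  have /forall_inP/(_ _ yS)/forall_inP/(_ _ zS)/implyP := trL _ xS.
  by apply; rewrite xy.
have ext x y : x \in S -> y \in S -> (x, y) \in P -> (x, y) \in Ls (h t).
  by move=> xS yS; have /forall_inP/(_ _ yS)/implyP := PL _ xS.
have bau : (b u, a u) \in Ls (h t).
  have /forall_inP/(_ _ (bS u)) := totL _ (aS u).
  by rewrite htu (negPf (hP u)).
have atbu : (a t, b u) \in Ls (h t) by apply: ext; rewrite ?abP.
have aubt : (a u, b t) \in Ls (h t) by apply: ext; rewrite ?abP // eq_sym.
have /negP[] := hP t.
by apply: (tr _ (b u)) => //; apply: (tr _ (a u)).
Qed.

Lemma standard_example_dim_gt (n d N : nat) (T : finType)
    (g : 'I_n -> {ffun T -> 'I_N}) (S : {set 'I_n}) :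
  d < #|T| ->
  contains (@standard_rank T) [set: T] [set g x | x in S] ->
  ~~ dim_le [set xy | [forall t, g xy.1 t <= g xy.2 t]] S d.
Proof.
move=> ltdT [p [pS ltp]].
have /fin_all_exists[p' p'P] k : exists x, x \in S /\ p k = g x.
  by have /imsetP[x] := pS k; exists x.
apply: (@dim_standard_example _ _ _ _ T (fun t => p' (false, t))
  (fun t => p' (true, t))) => // [t|t|t u].
- by have [] := p'P (false, t).
- by have [] := p'P (true, t).
rewrite inE /=.
have [_ <-] := p'P (false, t); have [_ <-] := p'P (true, u).
have [<-|tu] := eqVneq t u.
  apply/negbTE/forallPn; exists t; rewrite -ltnNge.
  by apply: ltp; rewrite ?inE // /standard_rank !eqxx !inordK.
apply/forallP=> v; apply/ltnW/ltp; rewrite ?inE // /standard_rank.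
have [etv|_] := eqVneq t v; last by case: (u == v); rewrite !inordK.
by rewrite -etv eq_sym (negPf tu) !inordK.
Qed.

(** * The poset of grid points and the bound *)

Lemma grid_order_is_poset (n N : nat) (T : finType)
    (g : 'I_n -> {ffun T -> 'I_N}) :
  injective g -> is_poset [set xy | [forall t, g xy.1 t <= g xy.2 t]].
Proof.
move=> injg; apply/and3P; split.
- by apply/forallP=> x; rewrite inE; apply/forallP.
- apply/forallP=> x; apply/forallP=> y; rewrite !inE /=.
  apply/implyP=> /andP[/forallP xy /forallP yx]; apply/eqP/injg/ffunP=> t.
  by apply/val_inj/eqP; rewrite eqn_leq xy yx.
apply/forallP=> x; apply/forallP=> y; apply/forallP=> z; rewrite !inE /=.
apply/implyP=> /andP[/forallP xy /forallP yz]; apply/forallP=> t.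
exact: leq_trans (xy t) (yz t).
Qed.

(* f_d(n) = O(n^(d/(d+1))), stated equivalently as f_d(n)^(d+1) = O(n^d). *)
Theorem theorem2 (d : nat) (hd : 0 < d) :
  exists C N : nat, forall n : nat, N <= n -> f_dim d n ^ d.+1 <= C * n ^ d.
Proof.
have [C HC] := @klazar_marcus _ _ _ (@standard_rank 'I_d.+1) d (isT : 0 < 4).
set s := 2 * 4 ^ 2 in HC.
exists (C ^ d.+1 * (s ^ d.+1) ^ d), 1 => n n0.
have s1 : 1 < s ^ d.+1 by rewrite -[1](expn0 s) ltn_exp2l.
(* With this [m], the side [N = s ^ m.+1] satisfies [n < N ^ d.+1 <= s ^ d.+1 * n]: the grid has
   room for [n] points, and the excess factor goes into the constant. *)
have := trunc_log_bounds s1 n0; set m := trunc_log _ _ => /andP[lem ltm].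
pose N := s ^ m.+1.
have NE : N ^ d.+1 = (s ^ d.+1) ^ m.+1 by rewrite /N -!expnM mulnC.
have len : n <= #|{ffun 'I_d.+1 -> 'I_N}| by rewrite card_ffun !card_ord NE ltnW.
pose g (x : 'I_n) : {ffun 'I_d.+1 -> 'I_N} := enum_val (widen_ord len x).
have injg : injective g by move=> x y /enum_val_inj/(congr1 val)/= /val_inj.
have lef : f_dim d n <= C * N ^ d.
  apply/bigmax_leqP => k /forallP/(_ [set xy | [forall t, g xy.1 t <= g xy.2 t]]).
  rewrite grid_order_is_poset //= => /existsP[S /andP[/eqP <- dimS]].
  rewrite -(card_imset _ injg); apply: (HC [set: 'I_d.+1] m.+1) => //.
  - by rewrite cardsT card_ord.
  - by move=> x y _ _ t; rewrite inE.
  - by move/standard_example_dim_gt => /(_ d); rewrite card_ord dimS => /(_ (ltnSn d)).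
apply: leq_trans (_ : (C * N ^ d) ^ d.+1 <= _); first by rewrite leq_exp2r.
rewrite expnMn -mulnA leq_mul2l; apply/orP; right.
rewrite -expnM mulnC expnM NE -expnMn leq_exp2r //.
by rewrite expnS leq_mul2l lem orbT.
Qed.
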